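(* Let $G$ be a finite unit-weight graph on $n$ vertices. There is $k\in\Theta(\varepsilon^{-2}\log^2 n)$ (i.e., $k=\lceil c\,\varepsilon^{-2}\log^2 n\rceil$ for a suitable absolute constant $c>0$) such that for every $\varepsilon>0$ and every vertex $v$, \[\rho^*_k(v)\in[(1+\varepsilon)^{-1}\rho^*(v),(1+\varepsilon)\rho^*(v)],\] where $\rho^*(v)$ is the local density of $v$ in $G$ and $\rho^*_k(v)$ is the local density of $v$ in the graph $H_k(v)$.
   Context: $H_k(v)$ is the $k$-hop neighbourhood of $v$: the subgraph of $G$ induced by the vertices at hop-distance at most $k$ from $v$. Unit-weight: all edge weights are $1$. Local density of a vertex $v$ in a graph $F=(V,E)$: for $B\subseteq V$ and nonempty $X\subseteq V\setminus B$, let $\hat E_B(X)$ be the set of edges with one endpoint in $X$ and the other in $X\cup B$, and $\hat\rho_B(X)=|\hat E_B(X)|/|X|$. Define $B_0=\emptyset$ and, while $B_{i-1}\ne V$, let $S_i$ be a (inclusion-wise largest) maximizer of $\hat\rho_{B_{i-1}}(X)$ over nonempty $X\subseteq V\setminus B_{i-1}$, and $B_i=B_{i-1}\cup S_i$. For $v\in S_i$, the local density of $v$ in $F$ is $\hat\rho_{B_{i-1}}(S_i)$.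
   Formalization: The claim with one absolute c for all ε>0 is false for large ε (projective-plane incidence graphs with ε=√c·log n, so k=1); instead, for each upper bound on ε there is a constant c>0, depending only on that bound, that works for all graphs, all such ε and all vertices v. *)

(* Defs.v *)
From mathcomp Require Import all_boot all_order all_algebra.
From mathcomp Require Import reals exp.

Set Implicit Arguments.
Unset Strict Implicit.
Unset Printing Implicit Defensive.

Import Order.TTheory GRing.Theory Num.Theory.
Local Open Scope ring_scope.

(* A finite simple graph is a symmetric irreflexive [adj : rel T]; a vertex set
   [V : {set T}] stands for the subgraph of [adj] induced by [V], so that the
   whole graph is [V = setT]. *)

Section LocalDensity.
Variables (R : realType) (T : finType) (adj : rel T).
Implicit Types (V B X Y S : {set T}) (u v : T) (i k : nat).

(* Edges are unordered pairs, so an edge inside X is counted once.  For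
   X and B contained in V, these are edges of the subgraph induced by V. *)
Definition incident_edges B X : {set {set T}} :=
  [set [set x; y] | x in X, y in X :|: B & adj x y].

Definition quotient_density B X : R := #|incident_edges B X|%:R / #|X|%:R.

Definition is_maximizer V B : pred {set T} := fun X =>
  [&& X != set0, X \subset V :\: B &
      [forall Y : {set T}, (Y != set0) && (Y \subset V :\: B) ==>
         (quotient_density B Y <= quotient_density B X)]].

(* Maximizers are closed under union, so the inclusion-maximal one is unique
   and is the largest.  The empty set is only returned when
   V \subset B, i.e. once the decomposition has terminated. *)
Definition next_layer V B : {set T} :=
  odflt set0 [pick S | maxset (is_maximizer V B) S].

(* Indices are shifted for the layers: [dense_layer V i] is S_(i+1), chosen
   relative to [dense_prefix V i] = B_i. *)
Definition dense_prefix V i : {set T} :=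
  iter i (fun B => B :|: next_layer V B) set0.

Definition dense_layer V i : {set T} := next_layer V (dense_prefix V i).

(* Layers are disjoint and nonempty until they exhaust V, so #|V| indices
   suffice and every v in V lies in exactly one layer; the value 0 is only
   used for v outside V. *)
Definition local_density V v : R :=
  if [pick i : 'I_#|V| | v \in dense_layer V i] is Some i
  then quotient_density (dense_prefix V i) (dense_layer V i)
  else 0.

Definition hop_nbhd k v : {set T} :=
  [set u | [exists m : 'I_k.+1, [exists p : m.-tuple T,
              path adj v p && (last v p == u)]]].

End LocalDensity.

(* For c >= 0 the ceiling is nonnegative, so the absolute value only converts
   it to nat.  For a fixed c the radius drops to 1 once eps >= sqrt c * ln n,
   while in the incidence graph of a projective plane of order q every local
   density is (q+1)/2 and every 1-hop neighbourhood is a star, of density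
   below 1: no single c can serve arbitrarily large eps. *)
Definition hop_radius (R : realType) (c eps : R) (n : nat) : nat :=
  `|Num.ceil (c * eps ^- 2 * ln (n%:R : R) ^+ 2)|%N.

(* Main.v *)
(** Write rho for the local density of v in G and rho' for that in the k-ball
    around v.  The layers up to that of v form a set P such that every Y inside
    P meets at least rho |Y| edges of G[P], while for the union M of the layers
    strictly before that of v, every Y outside M satisfies |E_M(Y)| <= rho |Y|.
    Playing the first property in the ball against the second one in G yields
    rho' <= rho.  Conversely, taking P in G and M in the ball, let Y_j be the
    part of P \ M within distance j of v.  Edges of G[P] meeting Y_j belong to
    E_M(Y_{j+1}), so rho |Y_j| <= rho' |Y_{j+1}|; if (1 + eps) rho' < rho, the
    Y_j would grow by a factor above 1 + eps at each step, and
    |Y_k| > (1 + eps)^k >= n. *)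

Require Import Defs.
From mathcomp Require Import all_boot all_order all_algebra.
From mathcomp Require Import reals exp.
From mathcomp Require Import sequences ring lra.

Import Order.TTheory GRing.Theory Num.Theory.
Local Open Scope ring_scope.

Section LocalDensityTheory.
Set Implicit Arguments.
Unset Strict Implicit.
Unset Printing Implicit Defensive.
Variables (R : realType) (T : finType) (adj : rel T).
Hypothesis adj_sym : symmetric adj.
Implicit Types (V W B M P S X Y Z : {set T}) (v x y : T) (r : R).

Local Notation inc := (incident_edges adj).
Local Notation layer V i := (dense_layer R adj V i).
Local Notation prefix V i := (dense_prefix R adj V i).
Local Notation qd := (quotient_density R adj).

(** * Counting incident edges *)

Lemma incident_edgesP B X (e : {set T}) :
  reflect (exists x y, [/\ x \in X, y \in X :|: B, adj x y & e = [set x; y]])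
          (e \in inc B X).
Proof.
apply: (iffP imset2P) => [[x y xX]|[x [y [xX yXB xy ->]]]].
  by rewrite inE => /andP[yXB xy] ->; exists x, y.
by exists x y; rewrite ?inE // -in_setU yXB.
Qed.

Lemma incident_edges_sub B B' X X' :
  X \subset X' -> X :|: B \subset X' :|: B' -> inc B X \subset inc B' X'.
Proof.
move=> /subsetP sX /subsetP sB; apply/subsetP => e.
case/incident_edgesP=> x [y [xX yXB xy ->]].
by apply/incident_edgesP; exists x, y; rewrite sX ?sB.
Qed.

(** An edge of the first set has both endpoints in [P], while one of the second has an endpoint in
    [Z]. *)
Lemma incident_edges_disjoint B P X Z :
  X :|: B \subset P -> [disjoint Z & P] ->
  forall B', [disjoint inc B X & inc B' Z].
Proof.
move=> /subsetP sP dZ B'; rewrite -setI_eq0; apply/eqP/setP => e.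
rewrite in_set0 inE; apply/negP => /andP[].
case/incident_edgesP=> x [y [xX yXB _ ->]].
case/incident_edgesP=> z [w [zZ _ _ /setP/(_ z)]].
rewrite !inE eqxx /=.
have xP : x \in P by apply: sP; rewrite inE xX.
have yP := sP y yXB.
have zP : z \notin P by rewrite (disjointFr dZ zZ).
by case/orP=> /eqP zE; rewrite zE ?xP ?yP in zP.
Qed.

(** An edge touching [Z] is counted from that endpoint, its other end lying in [S] or [B]; any other
    edge survives the removal of [Z]. *)
Lemma incident_edges_split B S Z :
  inc B S \subset inc (B :|: S) Z :|: inc B (S :\: Z).
Proof.
apply/subsetP => e /incident_edgesP[x [y [xS yS xy ->]]]; rewrite inE.
have [xZ|xZ] := boolP (x \in Z).
  apply/orP; left; apply/incident_edgesP; exists x, y; split=> //.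
  by move: yS; rewrite !inE => /orP[]->; rewrite ?orbT.
have [yZ|yZ] := boolP (y \in Z).
  apply/orP; left; apply/incident_edgesP; exists y, x; split=> //.
  - by rewrite !inE xS !orbT.
  - by rewrite adj_sym.
  - by rewrite setUC.
apply/orP; right; apply/incident_edgesP; exists x, y.
by move: yS; rewrite !inE xZ yZ xS.
Qed.

(** * Sparsity and density certificates *)

Definition sparse_outside V B r := forall Y, Y \subset V :\: B ->
  #|inc B Y|%:R <= r * #|Y|%:R.

(** No ambient vertex set occurs: the edges counted lie inside [P], so the condition is the same in
    every induced subgraph containing [P]. *)
Definition dense_inside P r := forall Y, Y \subset P ->
  r * #|Y|%:R <= #|inc P Y|%:R.

(** Both conditions are tested on [P :\: M]: an edge inside [P] meeting this set has its other end
    in it or in [M]. *)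
Lemma dense_sparse_le V P M r r' : P \subset V ->
  dense_inside P r -> sparse_outside V M r' -> ~~ (P \subset M) -> r <= r'.
Proof.
move=> sPV dP sM; rewrite -setD_eq0 -card_gt0 => Y0.
have := le_trans (dP _ (subsetDl P M)) _; move/(_ (r' * #|P :\: M|%:R)).
rewrite ler_pM2r ?ltr0n //; apply; apply: le_trans (sM _ (setSD _ sPV)).
rewrite ler_nat subset_leq_card //; apply: incident_edges_sub => //.
by apply/subsetP=> x; rewrite !inE; case: (x \in M); rewrite ?orbT //= orbb orbF.
Qed.

Lemma quotient_density_ge0 B X : 0 <= qd B X.
Proof. by rewrite divr_ge0. Qed.

Lemma quotient_densityK B X : qd B X * #|X|%:R = #|inc B X|%:R.
Proof.
have [->|X0] := eqVneq X set0; last by rewrite divfK // pnatr_eq0 cards_eq0.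
rewrite cards0 mulr0; apply/esym/eqP; rewrite pnatr_eq0 cards_eq0.
apply/eqP/setP=> e; rewrite in_set0.
by apply/negP => /incident_edgesP[x [y []]]; rewrite inE.
Qed.

(** * Layers of the decomposition *)

Variant next_layer_spec V B : {set T} -> Type :=
  | NextLayer S of S != set0 & S \subset V :\: B
      & sparse_outside V B (qd B S) : next_layer_spec V B S
  | NoNextLayer of V \subset B : next_layer_spec V B set0.

Lemma next_layerP V B : next_layer_spec V B (next_layer R adj V B).
Proof.
rewrite /next_layer; case: pickP => [S /maxsetp|none] /=.
  move=> /and3P[S0 sS /forallP S_max]; left=> // Y sY.
  have [->|Y0] := eqVneq Y set0; first by rewrite -quotient_densityK cards0 !mulr0.
  by rewrite -quotient_densityK ler_wpM2r //; move: (S_max Y); rewrite Y0 sY.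
(* If vertices remain, some candidate has the largest density and extends to an inclusion-maximal
   maximizer, so [pick] cannot fail. *)
right; rewrite -setD_eq0; apply: contraT => VB0.
pose Q X := (X != set0) && (X \subset V :\: B).
have Q0 : Q (V :\: B) by rewrite /Q VB0 /=.
case: (@Order.TotalTheory.arg_maxP _ _ _ (V :\: B) Q (qd B) Q0) => S /andP[S0 sS] S_max.
have mS : is_maximizer R adj V B S.
  by apply/and3P; split=> //; apply/forallP => Y; apply/implyP => /S_max.
have [A mA _] := maxset_exists mS.
by move: (none A); rewrite mA.
Qed.

(** [Y] is split along [B]: the edges inside [B] at [Y1] and the edges at [Y2] are disjoint
    families, each large enough for its own part. *)
Lemma dense_inside_step V B S r : S \subset V :\: B ->
  dense_inside B r -> r <= qd B S -> sparse_outside V B (qd B S) ->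
  dense_inside (B :|: S) r.
Proof.
move=> sS dB rS spB Y sY.
pose Y1 := Y :&: B; pose Y2 := Y :\: B.
have sY2 : Y2 \subset S.
  apply/subsetP => x; rewrite inE => /andP[xB xY].
  by move: (subsetP sY x xY); rewrite inE (negPf xB).
have cY : #|Y|%:R = #|Y1|%:R + #|Y2|%:R :> R by rewrite -natrD cardsID.
(* Removing [Y2] from [S] leaves a set of density at most that of [S], so at least [qd B S * #|Y2|]
   edges are lost, and all of them touch [Y2]. *)
have dY2 : r * #|Y2|%:R <= #|inc (B :|: S) Y2|%:R.
  have sSY : S :\: Y2 \subset V :\: B by apply: subset_trans sS; apply: subsetDl.
  have := spB _ sSY.
  have : #|inc B S|%:R <= #|inc (B :|: S) Y2|%:R + #|inc B (S :\: Y2)|%:R :> R.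
    rewrite -natrD ler_nat; apply: leq_trans (leq_card_setU _ _).
    by apply: subset_leq_card; apply: incident_edges_split.
  rewrite -quotient_densityK.
  have -> : #|S|%:R = #|Y2|%:R + #|S :\: Y2|%:R :> R.
    by rewrite -natrD -(cardsID Y2 S) (setIidPr sY2).
  have := ler_wpM2r (ler0n R #|Y2|) rS.
  by rewrite mulrDr; lra.
have dj : [disjoint inc B Y1 & inc (B :|: S) Y2].
  apply: (@incident_edges_disjoint _ B); first by rewrite subUset subsetIr subxx.
  by rewrite -setI_eq0 /Y2 setDE -setIA [~: B :&: B]setIC setICr setI0.
have le_sum : (#|inc B Y1| + #|inc (B :|: S) Y2| <= #|inc (B :|: S) Y|)%N.
  have [_ /esym] := leq_card_setU (inc B Y1) (inc (B :|: S) Y2).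
  rewrite dj => /esym/eqP <-; apply: subset_leq_card; rewrite subUset.
  apply/andP; split; apply: incident_edges_sub.
  - exact: subsetIl.
  - by apply/subsetP=> x; rewrite !inE => /orP[/andP[->]|->]; rewrite ?orbT.
  - exact: subsetDl.
  - by rewrite setSU // subsetDl.
rewrite cY mulrDr; apply: le_trans (lerD (dB _ (subsetIr _ _)) dY2) _.
by rewrite -natrD ler_nat.
Qed.

(* Otherwise S :|: S' would be denser than S relative to B. *)
Lemma next_layer_density_anti V B (S := next_layer R adj V B) :
  qd (B :|: S) (next_layer R adj V (B :|: S)) <= qd B S.
Proof.
rewrite {}/S; case: next_layerP => [S S0 sS spS|sVB]; last first.
  rewrite setU0; case: next_layerP => [S S0 sS _|_] //.
  move: sVB; rewrite -setD_eq0 => /eqP VB0.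
  by move: S0; rewrite -subset0 -VB0 sS.
(* Once the vertices are exhausted, the default layer [set0] has density 0. *)
case: next_layerP => [S' S'0 sS' _|_]; last first.
  by rewrite {1}/quotient_density cards0 invr0 mulr0 quotient_density_ge0.
have S'gt0 : 0 < #|S'|%:R :> R by rewrite ltr0n card_gt0.
rewrite -(ler_pM2r S'gt0) quotient_densityK.
have dSS' : [disjoint S' & S :|: B].
  rewrite -setI_eq0 -subset0; apply/subsetP => x; rewrite !inE => /andP[xS'].
  by move: (subsetP sS' x xS'); rewrite !inE orbC => /andP[/negPf->].
have sSS' : S :|: S' \subset V :\: B.
  rewrite subUset sS; apply: subset_trans sS' _.
  by rewrite setDS // subsetUl.
have := spS _ sSS'.
have cSS' : #|S :|: S'|%:R = #|S|%:R + #|S'|%:R :> R.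
  rewrite -natrD cardsU -[LHS]/(_%:R); congr (_%:R).
  suff -> : S :&: S' = set0 by rewrite cards0 subn0.
  apply/eqP; rewrite setIC setI_eq0.
  by apply: disjointWr dSS'; apply: subsetUl.
have : (#|inc B S| + #|inc (B :|: S) S'| <= #|inc B (S :|: S')|)%N.
  have dj := incident_edges_disjoint (subxx (S :|: B)) dSS' (B :|: S).
  have [_ /esym] := leq_card_setU (inc B S) (inc (B :|: S) S').
  rewrite dj => /esym/eqP <-; apply: subset_leq_card; rewrite subUset.
  apply/andP; split; apply: incident_edges_sub.
  - exact: subsetUl.
  - by rewrite setSU // subsetUl.
  - exact: subsetUr.
  - by rewrite [B :|: S]setUC setUA [S' :|: S]setUC.
rewrite -(ler_nat R) natrD cSS' mulrDr quotient_densityK; lra.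
Qed.

(** Layer densities do not increase with the index, so the bound for the earlier prefix persists at
    the new density, and [dense_inside_step] adds the new layer. *)
Lemma dense_inside_prefix V i :
  dense_inside (prefix V i.+1) (qd (prefix V i) (layer V i)).
Proof.
elim: i => [|i IHi].
  rewrite /dense_layer /=; case: next_layerP => [S S0 sS spS|_].
    apply: (@dense_inside_step V) => // Y.
    by rewrite subset0 => /eqP->; rewrite cards0 mulr0.
  by move=> Y; rewrite setU0 subset0 => /eqP->; rewrite cards0 mulr0.
have le_q := next_layer_density_anti V (prefix V i).
have dB : dense_inside (prefix V i.+1) (qd (prefix V i.+1) (layer V i.+1)).
  by move=> Y /IHi; apply: le_trans; apply: ler_wpM2r.
have -> : prefix V i.+2 = prefix V i.+1 :|: layer V i.+1 by [].
move: dB; rewrite /dense_layer; case: next_layerP => [S S0 sS spS|_] dB.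
  exact: (@dense_inside_step V).
by rewrite setU0.
Qed.

Lemma prefix_sub V i : prefix V i \subset V.
Proof.
elim: i => [|i IHi] /=; first exact: sub0set.
rewrite subUset IHi; case: next_layerP => [S _ sS _|_]; last exact: sub0set.
by apply: subset_trans sS _; apply: subsetDl.
Qed.

Lemma mem_prefix_layer V i v :
  v \in prefix V i -> exists2 j, (j < i)%N & v \in layer V j.
Proof.
elim: i => [|i IHi] /=; first by rewrite inE.
rewrite inE => /orP[/IHi[j ji vj]|vi]; last by exists i.
by exists j => //; apply: ltnW.
Qed.

Lemma prefix_exhausts V : prefix V #|V| = V.
Proof.
have card_prefix i : (i <= #|V| -> i <= #|prefix V i|)%N.
  elim: i => [//|i IHi] iV /=; have := IHi (ltnW iV).
  case: next_layerP => [S S0 sS _|sV] le_i.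
    rewrite cardsU (_ : _ :&: S = set0) ?cards0 ?subn0.
      by rewrite -addn1 leq_add // card_gt0.
    apply/eqP; rewrite -subset0; apply/subsetP => x; rewrite inE => /andP[xB xS].
    by move: (subsetP sS x xS); rewrite inE xB.
  by rewrite setU0 (leq_trans iV) // subset_leq_card.
by apply/eqP; rewrite eqEcard prefix_sub card_prefix.
Qed.

(** * Local density through certificates *)

Lemma local_density_ge0 V v : 0 <= local_density R adj V v.
Proof.
by rewrite /local_density; case: pickP => // i _; apply: quotient_density_ge0.
Qed.

(** [M] and [P] are the prefixes just before and just after the layer of [v]. By [dense_sparse_le]
    at most one value admits such a pair, so this characterizes the local density. *)
Lemma local_densityP V v (r := local_density R adj V v) : v \in V ->
  exists M P, [/\ v \in P :\: M, P \subset V, sparse_outside V M r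
                & dense_inside P r].
Proof.
rewrite {}/r => vV; rewrite /local_density; case: pickP => [i vi|none]; last first.
  have : v \in prefix V #|V| by rewrite prefix_exhausts.
  by case/mem_prefix_layer => j jV vj; move: (none (Ordinal jV)); rewrite vj.
exists (prefix V i), (prefix V i.+1); split.
- rewrite /= !inE vi orbT andbT.
  move: vi; rewrite /dense_layer; case: next_layerP => [S _ sS _|];
    last by rewrite inE.
  by move=> vS; move: (subsetP sS v vS); rewrite inE => /andP[].
- exact: prefix_sub.
- move: vi; rewrite /dense_layer; case: next_layerP => [S _ _ //|].
  by rewrite inE.
- exact: dense_inside_prefix.
Qed.

Lemma local_density_mono V W v : V \subset W -> v \in V ->
  local_density R adj V v <= local_density R adj W v.
Proof.
move=> sVW vV; have [M' [P [vP sPV _ dP]]] := local_densityP vV.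
have [M [P' [vM _ sM _]]] := local_densityP (subsetP sVW v vV).
move: vP vM; rewrite !inE => /andP[_ vP] /andP[vM _].
apply: dense_sparse_le (subset_trans sPV sVW) dP sM _.
by apply/subsetPn; exists v.
Qed.

(** * Hop balls and growth *)

Local Notation ball v k := (hop_nbhd adj k v).

Lemma hop_nbhd_center k v : v \in ball v k.
Proof.
rewrite inE; apply/existsP; exists ord0; apply/existsP; exists [tuple].
by rewrite /= eqxx.
Qed.

Lemma hop_nbhd_mono j k v : (j <= k)%N -> ball v j \subset ball v k.
Proof.
move=> jk; apply/subsetP => x; rewrite !inE => /existsP[m /existsP[p px]].
by apply/existsP; exists (widen_ord (jk : (j < k.+1)%N) m); apply/existsP; exists p.
Qed.

Lemma hop_nbhd_adj k v x y : x \in ball v k -> adj x y -> y \in ball v k.+1.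
Proof.
rewrite !inE => /existsP[m /existsP[p /andP[vp /eqP px]]] xy.
apply/existsP; exists (lift ord0 m); apply/existsP; exists [tuple of rcons p y].
by rewrite /= rcons_path last_rcons vp px xy eqxx.
Qed.

(** Iterates [r * #|Y j| <= r' * #|Y j.+1|], starting from [v] in [Y 0]. Powers replace quotients,
    so that [r' = 0] is covered. *)
Lemma ball_growth P M v k r r' : 0 <= r -> 0 <= r' -> v \in P :\: M ->
  dense_inside P r -> sparse_outside (ball v k) M r' ->
  forall j, (j <= k)%N ->
    r ^+ j <= r' ^+ j * #|(P :&: ball v j) :\: M|%:R.
Proof.
move=> r0 r'0 vPM dP sM; elim=> [_|j IHj jk].
  rewrite !expr0 mul1r ler1n card_gt0; apply/set0Pn; exists v.
  move: vPM; rewrite !in_setD in_setI => /andP[-> ->].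
  exact: hop_nbhd_center.
pose Y i := (P :&: ball v i) :\: M.
(* Sparsity is known only inside the ball of radius [k], hence the bound [j < k]. *)
have sY : Y j.+1 \subset ball v k :\: M.
  by rewrite setSD // (subset_trans (subsetIr _ _)) // hop_nbhd_mono.
have sYP : Y j \subset P by rewrite (subset_trans (subsetDl _ _)) // subsetIl.
(* A neighbour in [P] of a vertex of [Y j] is one hop further at most, so it lies in [Y j.+1] or in
   [M]. *)
have le_inc : (#|inc P (Y j)| <= #|inc M (Y j.+1)|)%N.
  apply/subset_leq_card/subsetP => e /incident_edgesP[x [y [xY + xy ->]]].
  rewrite (setUidPr sYP) => yP; apply/incident_edgesP; exists x, y.
  move: xY; rewrite /Y in_setD in_setI => /andP[xM /andP[xP xj]].
  rewrite in_setD in_setI xM xP (subsetP (hop_nbhd_mono v (leqnSn j))) //.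
  by split=> //; rewrite in_setU in_setD in_setI yP (hop_nbhd_adj xj xy) /= andbT orNb.
have rY : r * #|Y j|%:R <= r' * #|Y j.+1|%:R.
  apply: le_trans (dP _ sYP) (le_trans _ (sM _ sY)).
  by rewrite ler_nat.
rewrite !exprSr -mulrA; apply: le_trans (ler_wpM2r r0 (IHj (ltnW jk))) _.
by rewrite -mulrA ler_wpM2l ?exprn_ge0 // mulrC.
Qed.

Lemma local_density_ball k v (a : R) : 1 <= a -> #|T|%:R <= a ^+ k ->
  local_density R adj [set: T] v <= a * local_density R adj (ball v k) v.
Proof.
move=> a1 Ta; set r := local_density _ _ _ _; set r' := local_density _ _ _ _.
have a0 : 0 <= a by apply: le_trans a1.
have r0 : 0 <= r := local_density_ge0 _ v.
have r'0 : 0 <= r' := local_density_ge0 _ v.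
(* The strict comparison of [k]-th powers below requires [k > 0]; for [k = 0] the graph has a single
   vertex. *)
have [k0|k0] := posnP k.
  have ballT : ball v k = [set: T].
    apply/eqP; rewrite eqEcard subsetT cardsT /=.
    apply: (@leq_trans 1); first by move: Ta; rewrite k0 expr0 -(ler_nat R).
    by rewrite card_gt0; apply/set0Pn; exists v; apply: hop_nbhd_center.
  by rewrite /r /r' ballT ler_peMl // local_density_ge0.
rewrite leNgt; apply/negP => lt_r.
have [M' [P [vP _ _ dP]]] := local_densityP (in_setT v).
have [M [P' [vM _ sM _]]] := local_densityP (hop_nbhd_center k v).
have vPM : v \in P :\: M by move: vP vM; rewrite !inE => /andP[_ ->] /andP[->].
(* The contradiction is [r ^+ k <= r' ^+ k * #|T| <= (a * r') ^+ k < r ^+ k]. *)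
have := ball_growth r0 r'0 vPM dP sM (leqnn k); apply/negP; rewrite -ltNge.
apply: (@le_lt_trans _ _ ((a * r') ^+ k)); last first.
  by rewrite ltrXn2r ?mulr_ge0 // -lt0n.
rewrite exprMn mulrC ler_wpM2r ?exprn_ge0 //.
by apply: le_trans Ta; rewrite ler_nat max_card.
Qed.

End LocalDensityTheory.

(** * Numerical estimate for the radius *)

Lemma expR_le1Dx (R : realType) (x : R) : 0 <= x -> expR (x / (1 + x)) <= 1 + x.
Proof.
move=> x0; have x1 : 0 < 1 + x by lra.
(* This is [1 - t <= expR (- t)] at [t = x / (1 + x)]; inverting it gives the claim. *)
have : (1 + x)^-1 <= expR (- (x / (1 + x))).
  apply: le_trans (expR_ge1Dx _).
  suff /eqP : (1 + x)^-1 = 1 + - (x / (1 + x)) by rewrite eq_le => /andP[].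
  by field; lra.
by rewrite expRN lef_pV2 // posrE expR_gt0.
Qed.

(** Since [1 + eps >= expR (eps / (1 + eps))], it suffices that [k * eps / (1 + eps) >= ln n]. In
    the constant, [m * (1 + m)] dominates [eps * (1 + eps)], and the factor 2 pays for replacing
    [ln n] by its square. *)
Lemma hop_radius_growth (R : realType) (m eps : R) (n : nat) :
  0 < eps -> eps <= m ->
  n%:R <= (1 + eps) ^+ hop_radius (2 * m * (1 + m)) eps n.
Proof.
move=> eps0 epsm; case: n => [|n]; first by rewrite exprn_ge0 //; lra.
set k := hop_radius _ _ _; set L := ln (n.+1%:R : R).
have L0 : 0 <= L by rewrite ln_ge0 // ler1n.
have expL : expR L = n.+1%:R by rewrite lnK // posrE.
(* Either [L = 0], or there are at least two vertices and [1 - L <= expR (- L) <= 1 / 2]. *)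
have L2 : L <= 2 * L ^+ 2.
  have [n0|n0] := posnP n; first by rewrite /L n0 ln1 expr0n mulr0.
  suff : 2^-1 <= L by nra.
  have := expR_ge1Dx (- L); rewrite expRN expL => le1.
  have : (n.+1%:R : R)^-1 <= 2^-1 by rewrite lef_pV2 ?posrE // ler_nat.
  move=> le2; have := le_trans le1 le2; rewrite lerBlDl; lra.
have kL : 2 * m * (1 + m) * eps ^- 2 * L ^+ 2 <= k%:R.
  apply: le_trans (ceil_ge _) _.
  by rewrite /k /hop_radius natr_absz ler_int ler_norm.
have keps : L <= k%:R * (eps / (1 + eps)).
  apply: le_trans L2 _.
  have y0 : 0 <= eps / (1 + eps) by rewrite divr_ge0; lra.
  apply: le_trans (ler_wpM2r y0 kL).
  have -> : 2 * m * (1 + m) * eps ^- 2 * L ^+ 2 * (eps / (1 + eps)) =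
            2 * L ^+ 2 * (m * (1 + m) / (eps * (1 + eps))).
    by field; rewrite !lt0r_neq0 //; lra.
  rewrite ler_peMr ?mulr_ge0 ?exprn_ge0 // ler_pdivlMr; nra.
rewrite -expL; apply: le_trans (_ : expR (k%:R * (eps / (1 + eps))) <= _).
  by rewrite ler_expR.
by rewrite expRM_natl lerXn2r ?nnegrE ?expR_ge0 ?expR_le1Dx //; lra.
Qed.

Theorem theorem14 (R : realType) (eps_max : R) :
  exists2 c : R, 0 < c &
    forall (T : finType) (adj : rel T), symmetric adj -> irreflexive adj ->
    forall eps : R, 0 < eps -> eps <= eps_max ->
    forall v : T,
      let k := hop_radius c eps #|T| in
      let rho := local_density R adj [set: T] v in
      let rho_k := local_density R adj (hop_nbhd adj k v) v in
      rho_k \in `[(1 + eps)^-1 * rho, (1 + eps) * rho].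
Proof.
(* In this case no [eps] is admissible and any positive constant will do. *)
have [m0|m0] := leP eps_max 0.
  exists 1 => // T adj _ _ eps eps0 /le_trans/(_ m0).
  by rewrite leNgt eps0.
exists (2 * eps_max * (1 + eps_max)) => [|T adj adj_sym _ eps eps0 eps_le v /=].
  by rewrite !mulr_gt0 // addr_gt0.
have a1 : 1 <= 1 + eps by rewrite lerDl ltW.
have a0 : 0 < 1 + eps by apply: lt_le_trans a1.
rewrite in_itv /= ler_pdivrMl //; apply/andP; split.
  by apply: local_density_ball => //; apply: hop_radius_growth.
(* The upper bound holds even without the factor [1 + eps], by monotonicity in the vertex set. *)
apply: (@le_trans _ _ (local_density R adj [set: T] v)); last by rewrite ler_peMl // local_density_ge0.
by apply: local_density_mono; rewrite ?subsetT // hop_nbhd_center.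
Qed.
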